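(* Let $\mathcal L$ be one of the Magic Star algebras $\mathbf{e}_6^{(n)},\mathbf{e}_7^{(n)},\mathbf{e}_8^{(n)}$, $n\ge 1$, over $\mathfrak F$, let $(r,s)\in\{(1,1),(1,-1),(-1,1),(-1,-1),(0,2),(0,-2)\}$, and let $\mathfrak g_0$, $T_{(r,s)}$, $T_{(-r,-s)}$ and $\mathbf C=\mathbf C_{(r,s)}$ be the subspaces of $\mathcal L$ defined in the context. Then $\mathfrak g_0$ is a subalgebra of $\mathcal L$; $T_{(r,s)}$ is a subalgebra with trivial product, $[T_{(r,s)},T_{(r,s)}]=0$; and $$\mathfrak g_{III}:=\mathfrak g_0\oplus\mathbf C\oplus T_{(r,s)}\oplus T_{(-r,-s)}$$ is a subalgebra of $\mathcal L$ which is three-graded, with $\mathfrak g_0\oplus\mathbf C$ in grade $0$, $T^+:=T_{(r,s)}$ in grade $1$ and $T^-:=T_{(-r,-s)}$ in grade $-1$.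
   Context: Notation. Let $\mathfrak F$ be a field of characteristic $0$, $n\ge1$ an integer, $N=4(n+1)$, and $k_1,\dots,k_N$ an orthonormal basis of a Euclidean space with scalar product $(\cdot,\cdot)$. The set of generalized roots is $\Phi=\Phi_O\cup\Phi_S$, where: - for $\mathbf e_8^{(n)}$ (rank $R=N$): $\Phi_O=\{\pm k_i\pm k_j: 1\le i<j\le N\}$, $\Phi_S=\{\frac12(\pm k_1\pm\dots\pm k_N)$ with an even number of $+$ signs$\}$; - for $\mathbf e_7^{(n)}$ (rank $R=N-1$): the elements of the set $\{\pm k_i\pm k_j: 1\le i<j\le N\}\cup\{\frac12(\pm k_1\pm\dots\pm k_N)$ with an even number of $+$ signs$\}$ (the generalized roots of $\mathbf e_8^{(n)}$) that are orthogonal to $k_{N-1}-k_N$, i.e. $\Phi_O=\{\pm k_i\pm k_j:1\le i<j\le N-2\}\cup\{\pm(k_{N-1}+k_N)\}$, $\Phi_S=\{\frac12(\pm k_1\pm\dots\pm k_{N-2}\pm(k_{N-1}+k_N))$ with an even number of $+$ signs$\}$; - for $\mathbf e_6^{(n)}$ (rank $R=N-2$): $\Phi_O=\{\pm k_i\pm k_j:1\le i<j\le N-3\}$, $\Phi_S=\{\frac12(\pm k_1\pm\dots\pm k_{N-3}\pm(k_{N-2}+k_{N-1}+k_N))$ with an even number of $+$ signs$\}$. The ordered simple generalized roots are $\alpha_i=k_i-k_{i+1}$ ($1\le i\le R-2$), $\alpha_{R-1}=k_{R-2}+k_{R-1}$, $\alpha_R=-\frac12(k_1+\dots+k_N)$,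 with $\alpha_i<\alpha_j$ for $i<j$. Every element of $\Phi$ is an integer combination of them. Let $\mathbb L=\bigoplus_i\mathbb Z\alpha_i$. The asymmetry function $\varepsilon:\mathbb L\times\mathbb L\to\{-1,1\}$ is $\varepsilon(\sum_i\ell_i\alpha_i,\sum_j m_j\alpha_j)=\prod_{i,j}\varepsilon(\alpha_i,\alpha_j)^{\ell_im_j}$, where $\varepsilon(\alpha_i,\alpha_j)=-1$ if $i=j$, $=-1$ if $\alpha_i+\alpha_j\in\Phi$ and $i<j$, and $=+1$ otherwise. The Magic Star algebra $\mathcal L$ is the (in general non-Lie) algebra over $\mathfrak F$ with basis $\{h_1,\dots,h_R\}\cup\{x_\alpha:\alpha\in\Phi\}$ and bilinear product given by $[h_i,h_j]=0$; $[h_i,x_\alpha]=-[x_\alpha,h_i]=(\alpha,\alpha_i)x_\alpha$; $[x_\alpha,x_{-\alpha}]=-h_\alpha$; $[x_\alpha,x_\beta]=0$ if $\alpha+\beta\notin\Phi$ and $\alpha\neq-\beta$; $[x_\alpha,x_\beta]=\varepsilon(\alpha,\beta)x_{\alpha+\beta}$ if $\alpha+\beta\in\Phi$. Here $h_\lambda:=\sum_ic_ih_i$ for $\lambda=\sum_ic_i\alpha_i\in\mathbb L$. Magic Star projection. To a root $\alpha$ assign $(r,s)=\big((\alpha,k_1-k_2),(\alpha,k_1+k_2-2k_3)\big)$. The roots $\pm(k_1-k_2),\pm(k_2-k_3),\pm(k_3-k_1)$ have $(r,s)=\pm(2,0),\pm(-1,3),\pm(-1,-3)$; all other roots have $(r,s)=(0,0)$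 (the center of the Magic Star) or $(r,s)\in\{(\pm1,\pm1),(0,\pm2)\}$ with independent signs (the tips). $T_{(r,s)}$ is the span of the $x_\alpha$ with $\alpha$ of type $(r,s)$. $\mathfrak g_0$ is the span of the $x_\alpha$ and $h_\alpha$ with $\alpha$ of type $(0,0)$. $\mathbf C_{(r,s)}$ is the one-dimensional space of multiples of the Cartan element along the axis of the grading (the $(r,s)$ direction): it is spanned by $h_{k_1+k_2-2k_3}$ if $(r,s)=(0,\pm2)$, by $h_{2k_1-k_2-k_3}$ if $(r,s)=\pm(1,1)$, and by $h_{2k_2-k_1-k_3}$ if $(r,s)=\pm(-1,1)$. ''Three-graded'' means $[\mathfrak g_i,\mathfrak g_j]\subseteq\mathfrak g_{i+j}$ for the grades $i,j\in\{-1,0,1\}$, with $\mathfrak g_k=0$ for $|k|>1$. *)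

(* Defs.v *)
From HB Require Import structures.
From mathcomp Require Import all_boot all_order all_algebra.

Set Implicit Arguments.
Unset Strict Implicit.
Unset Printing Implicit Defensive.

Import Order.TTheory GRing.Theory Num.Theory.
Local Open Scope ring_scope.

Inductive star_kind := E6 | E7 | E8.

Definition edim (n : nat) : nat := (4 * n.+1)%N.

Definition rank (t : star_kind) (n : nat) : nat :=
  match t with
  | E8 => edim n
  | E7 => (edim n - 1)%N
  | E6 => (edim n - 2)%N
  end.

(* All the vectors involved are rational combinations of the orthonormal      *)
(* basis k_1, ..., k_N, so they are represented by coordinates in Q^N.        *)
Notation evec n := 'rV[rat]_(edim n).

(* Indices start at 1: kvec n i is k_i for 1 <= i <= N. *)
Definition kvec (n i : nat) : evec n := \row_j (j.+1 == i)%:R.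

Definition dot (n : nat) (u v : evec n) : rat := \sum_j u 0 j * v 0 j.

(* The vectors +-k_i+-k_j with 1 <= i < j <= m. *)
Definition pair_roots (n m : nat) : seq (evec n) :=
  flatten [seq [:: kvec n i + kvec n j; kvec n i - kvec n j;
                   - kvec n i + kvec n j; - kvec n i - kvec n j]
          | i <- iota 1 m, j <- iota i.+1 (m - i)].

Definition PhiO (t : star_kind) (n : nat) : seq (evec n) :=
  let N := edim n in
  match t with
  | E8 => pair_roots n N
  | E7 => pair_roots n (N - 2) ++
            [:: kvec n (N - 1) + kvec n N; - (kvec n (N - 1) + kvec n N)]
  | E6 => pair_roots n (N - 3)
  end.

(* A choice e of signs (true for +) for k_1, ..., k_N is admissible when the  *)
(* number of + signs is even and k_R, ..., k_N carry the same sign: this last *)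
(* block is {k_N}, {k_(N-1), k_N}, {k_(N-2), k_(N-1), k_N} for E8, E7, E6.    *)
Definition spin_signs (t : star_kind) (n : nat)
    (e : {ffun 'I_(edim n) -> bool}) : bool :=
  ~~ odd #|[set i | e i]| &&
  [forall i : 'I_(edim n), forall j : 'I_(edim n),
     (rank t n <= i.+1)%N && (rank t n <= j.+1)%N ==> (e i == e j)].

Definition spinor (n : nat) (e : {ffun 'I_(edim n) -> bool}) : evec n :=
  2^-1 *: \sum_i (if e i then kvec n i.+1 else - kvec n i.+1).

Definition PhiS (t : star_kind) (n : nat) : seq (evec n) :=
  [seq spinor e | e <- enum {ffun 'I_(edim n) -> bool} & spin_signs t e].

Definition Phi (t : star_kind) (n : nat) : seq (evec n) := PhiO t n ++ PhiS t n.

(* alpha_i for 1 <= i <= R. *)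
Definition simple_root (t : star_kind) (n i : nat) : evec n :=
  let R := rank t n in
  if (i <= R - 2)%N then kvec n i - kvec n i.+1
  else if i == (R - 1)%N then kvec n (R - 2) + kvec n (R - 1)
  else - (2^-1 *: \sum_(1 <= j < (edim n).+1) kvec n j).

Definition simple_roots (t : star_kind) (n : nat) : (rank t n).-tuple (evec n) :=
  [tuple simple_root t n i.+1 | i < rank t n].

(* For v in the lattice spanned by the (linearly independent) simple roots,   *)
(* the rational coordinates of v are integers, equal to their numerators.     *)
Definition scoef (t : star_kind) (n : nat) (v : evec n) (i : 'I_(rank t n)) :
    int :=
  numq (coord (simple_roots t n) i v).

Definition eps_simple (t : star_kind) (n : nat) (i j : 'I_(rank t n)) : int :=
  let a := tnth (simple_roots t n) in
  if i == j then -1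
  else if (a i + a j \in Phi t n) && (i < j)%N then -1
  else 1.

Definition eps (t : star_kind) (n : nat) (u v : evec n) : int :=
  \prod_(i < rank t n) \prod_(j < rank t n)
    eps_simple i j ^ (scoef u i * scoef v j).

Definition gen_root (t : star_kind) (n : nat) : finType := seq_sub (Phi t n).

Definition basis_index (t : star_kind) (n : nat) : finType :=
  ('I_(rank t n) + gen_root t n)%type.

(* The underlying space: coordinate families over the basis h_i, x_alpha. *)
Notation magic_star F t n := {ffun basis_index t n -> F^o}.

Section MagicStar.

Variables (F : fieldType) (t : star_kind) (n : nat).
Local Notation L := (magic_star F t n).
Implicit Types (u v : L) (U V W : {vspace L}).

Definition basis_elt (b : basis_index t n) : L := [ffun c => (c == b)%:R].
Definition hgen (i : 'I_(rank t n)) : L := basis_elt (inl i).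
Definition xgen (a : gen_root t n) : L := basis_elt (inr a).

Definition hvec (v : evec n) : L := \sum_i (scoef v i)%:~R *: hgen i.

Definition basis_bracket (b c : basis_index t n) : L :=
  match b, c with
  | inl i, inl j => 0
  | inl i, inr a => ratr (dot (val a) (tnth (simple_roots t n) i)) *: xgen a
  | inr a, inl i =>
      - (ratr (dot (val a) (tnth (simple_roots t n) i)) *: xgen a)
  | inr a, inr a' =>
      if val a' == - val a then - hvec (val a)
      else if insub (val a + val a') is Some a''
      then (eps t (val a) (val a'))%:~R *: xgen a''
      else 0
  end.

Definition bracket u v : L :=
  \sum_b \sum_c (u b * v c) *: basis_bracket b c.

Definition bracket_in U V W : Prop :=
  forall u v, u \in U -> v \in V -> bracket u v \in W.

Definition subalgebra U : Prop := bracket_in U U U.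

Definition three_graded (A : {vspace L}) (g : int -> {vspace L}) : Prop :=
  [/\ A = (g (-1)%R + g 0%R + g 1%R)%VS, directv (g (-1)%R + g 0%R + g 1%R),
      forall k : int, 1 < `|k| -> g k = 0%VS
    & forall i j : int, `|i| <= 1 -> `|j| <= 1 ->
        bracket_in (g i) (g j) (g (i + j))].

Definition star_type (v : evec n) : rat * rat :=
  let k := kvec n in
  (dot v (k 1%N - k 2%N), dot v (k 1%N + k 2%N - 2 *: k 3%N)).

Definition roots_of_type (r s : rat) : seq (gen_root t n) :=
  [seq a <- enum (gen_root t n) | star_type (val a) == (r, s)].

Definition tip_space (r s : rat) : {vspace L} :=
  <<[seq xgen a | a <- roots_of_type r s]>>%VS.

Definition center_space : {vspace L} :=
  <<[seq xgen a | a <- roots_of_type 0 0] ++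
    [seq hvec (val a) | a <- roots_of_type 0 0]>>%VS.

(* Only meaningful when (r, s) is one of the six tips. *)
Definition axis (r s : rat) : evec n :=
  let k := kvec n in
  if r == 0 then k 1%N + k 2%N - 2 *: k 3%N
  else if r == s then 2 *: k 1%N - k 2%N - k 3%N
  else 2 *: k 2%N - k 1%N - k 3%N.

Definition axis_space (r s : rat) : {vspace L} := <[hvec (axis r s)]>%VS.

Definition gIII (r s : rat) : {vspace L} :=
  (center_space + axis_space r s + tip_space r s + tip_space (- r) (- s))%VS.

Definition gIII_grade (r s : rat) (k : int) : {vspace L} :=
  if k == 0 then (center_space + axis_space r s)%VS
  else if k == 1 then tip_space r s
  else if k == -1 then tip_space (- r) (- s)
  else 0%VS.

End MagicStar.

Definition tips : seq (rat * rat) :=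
  [:: (1, 1); (1, -1); (-1, 1); (-1, -1); (0, 2); (0, -2)].

(* Main.v *)
Require Import Defs.
From HB Require Import structures.
From mathcomp Require Import all_boot all_order all_algebra.
From mathcomp Require Import zify ring lra.

Set Implicit Arguments.
Unset Strict Implicit.
Unset Printing Implicit Defensive.

Import Order.TTheory GRing.Theory Num.Theory.
Local Open Scope ring_scope.

(* The bracket respects the (r, s)-types.  A root projects to the span of     *)
(* k_1, k_2, k_3 with squared length at most 2, and r^2/2 + s^2/6 is the       *)
(* squared length of its projection to the smaller plane of k_1-k_2 and        *)
(* k_1+k_2-2k_3; twice a tip would give 8/3, so [T^+, T^+] = 0.  The only      *)
(* inclusion left is [T^+, T^-] <= g_0 + C, that is h_a in g_0 + C for a in a  *)
(* tip.  The roots of type (0, 0) yield, by rational combinations, k_i for     *)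
(* 4 <= i < R, k_1+k_2+k_3 and the all-minus spinor, hence everything in the   *)
(* span of the roots that is orthogonal to the plane, while the projection of  *)
(* a to the plane lies on the axis.  A rational relation between roots passes  *)
(* to the h's in characteristic 0, because roots have integer coordinates in   *)
(* the free family of simple roots.  The sum g_0 + C is direct because         *)
(* pairing with the axis kills h_a for a of type (0, 0) but not the axis.      *)

(** The type of a root is additive, so the product of basis elements of types p and q is a multiple
    of some x of type p + q or, for opposite roots, of h_alpha. [bracket_in_type] makes this a
    criterion: the target of a product of two grades must contain the root vectors of type p + q
    and, when q = - p, the elements h_alpha.

    The first requirement is a matter of definition except in grades 2 and -2, which are zero; there
    [star_type_bound] shows that no root exists ([gIII_grade_subv]). The second is [hvec_tip]: a
    root of a tip is a rational combination of roots of type (0, 0) and of the axis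
    ([tip_mem_span]), and [hrat_span] carries this relation to the Cartan elements, using that these
    vectors have integer coordinates in the simple roots ([in_lattice_Phi], [in_lattice_axis]).

    The sum is direct because the pieces have disjoint root supports ([cap_tip_space]), apart from
    g_0 and C, which [center_axis_direct] separates by a linear functional. *)

Definition kcoord (n i : nat) (v : evec n) : rat := dot v (kvec n i).

Lemma kcoord_is_linear (n i : nat) : linear (@kcoord n i : evec n -> rat^o).
Proof.
move=> c u v; rewrite /kcoord /dot scaler_sumr -big_split /=.
by apply: eq_bigr => j _; rewrite !mxE mulrDl scalerAl.
Qed.

HB.instance Definition _ (n i : nat) :=
  GRing.isLinear.Build rat (evec n) rat^o _ (@kcoord n i) (@kcoord_is_linear n i).

Lemma kcoord_ord (n : nat) (i : 'I_(edim n)) (v : evec n) :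
  kcoord i.+1 v = v 0 i.
Proof.
rewrite /kcoord /dot (bigD1 i) //= big1 ?addr0 => [|j neq_ji].
  by rewrite mxE eqxx mulr1.
by rewrite mxE eqSS val_eqE (negPf neq_ji) mulr0.
Qed.

Lemma kcoord_kvec (n i j : nat) : (0 < i <= edim n)%N ->
  kcoord i (kvec n j) = (i == j)%:R.
Proof. by case: i => // i ltiN; rewrite (kcoord_ord (Ordinal ltiN)) mxE. Qed.

Lemma kcoordZ (n i : nat) (c : rat) (v : evec n) :
  kcoord i (c *: v) = c * kcoord i v.
Proof. exact: linearZ. Qed.

Lemma kcoordD (n i : nat) (u v : evec n) :
  kcoord i (u + v) = kcoord i u + kcoord i v.
Proof. exact: raddfD. Qed.

Lemma kcoordN (n i : nat) (v : evec n) : kcoord i (- v) = - kcoord i v.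
Proof. exact: raddfN. Qed.

Definition kcoordE := (kcoordD, kcoordN, kcoordZ).

Lemma evec_kcoordP (n : nat) (u v : evec n) :
  (forall i, (0 < i <= edim n)%N -> kcoord i u = kcoord i v) -> u = v.
Proof.
move=> eq_uv; apply/rowP=> i.
by rewrite -!kcoord_ord eq_uv //= ltn_ord.
Qed.

Lemma kcoord_sum_kvec (n i a b : nat) (c : nat -> rat) : (0 < i <= edim n)%N ->
  kcoord i (\sum_(a <= j < b) c j *: kvec n j) = c i *+ (a <= i < b)%N.
Proof.
move=> iP; rewrite linear_sum /=.
under eq_bigr do rewrite kcoordZ kcoord_kvec //.
have [iab|niab] := boolP (a <= i < b)%N.
  rewrite (bigD1_seq i) ?iota_uniq ?mem_index_iota //= eqxx mulr1.
  by rewrite big1 ?addr0 // => j neq_ji; rewrite eq_sym (negPf neq_ji) mulr0.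
rewrite big_seq big1 // => j; rewrite mem_index_iota.
by case: eqP => [<-|_ _]; rewrite ?(negPf niab) ?mulr0.
Qed.

Lemma evec_expand (n : nat) (v : evec n) :
  v = \sum_(1 <= i < (edim n).+1) kcoord i v *: kvec n i.
Proof. by apply: evec_kcoordP => i iP; rewrite kcoord_sum_kvec // ltnS iP. Qed.

(** * Simple roots: expansion, freeness and integrality of coordinates *)

Definition rkm2 (t : star_kind) (n : nat) : nat := (rank t n - 2)%N.

Lemma rankE (t : star_kind) (n : nat) : rank t n = (rkm2 t n).+2.
Proof. by rewrite /rkm2; case: t => /=; rewrite /edim; lia. Qed.

Lemma rkm2_bounds (t : star_kind) (n : nat) : (1 <= n)%N ->
  (4 <= rkm2 t n <= edim n - 2)%N.
Proof. by rewrite /rkm2; case: t => /=; rewrite /edim; lia. Qed.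

Lemma simple_root_lt (t : star_kind) (n i : nat) : (i < rkm2 t n)%N ->
  simple_root t n i.+1 = kvec n i.+1 - kvec n i.+2.
Proof. by move=> lti; rewrite /simple_root -/(rkm2 t n) lti. Qed.

Lemma simple_root_vec (t : star_kind) (n : nat) :
  simple_root t n (rkm2 t n).+1 = kvec n (rkm2 t n) + kvec n (rkm2 t n).+1.
Proof. by rewrite /simple_root rankE !subSS !subn0 ltnn eqxx. Qed.

Lemma simple_root_spin (t : star_kind) (n : nat) :
  simple_root t n (rkm2 t n).+2 = - (2^-1 *: \sum_(1 <= j < (edim n).+1) kvec n j).
Proof.
rewrite /simple_root rankE !subSS !subn0 ltnNge leqnSn /=.
by rewrite -[_.+2 == _.+1]/(_.+1 == _) gtn_eqF.
Qed.

(** Equations of the R-dimensional span of the roots: the last two coordinates agree for E7, the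
    last three for E6, and nothing is imposed for E8. *)
Definition const_tail (t : star_kind) (n : nat) (v : evec n) :=
  forall i, (rank t n <= i <= edim n)%N -> kcoord i v = kcoord (edim n) v.

(* Coefficients in the simple roots: removing the spinor alpha_R leaves the    *)
(* coordinates [kdiff], the chain alpha_1, ..., alpha_(R-2) is then inverted   *)
(* by partial summation, and the branching at alpha_(R-1) splits off half of   *)
(* the total sum.                                                              *)
Definition kdiff (n : nat) (v : evec n) (i : nat) : rat :=
  kcoord i.+1 v - kcoord (edim n) v.

Definition halfdiff (t : star_kind) (n : nat) (v : evec n) : rat :=
  (\sum_(0 <= i < (rkm2 t n).+1) kdiff v i) / 2.

Definition simple_coef (t : star_kind) (n : nat) (v : evec n) (i : nat) : rat :=
  if (i < rkm2 t n)%N then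
    \sum_(0 <= j < i.+1) kdiff v j - (i.+1 == rkm2 t n)%:R * halfdiff t v
  else if i == rkm2 t n then halfdiff t v else - (2 * kcoord (edim n) v).

Lemma abel_telescope (R : pzRingType) (V : lmodType R) (d : nat -> R)
    (K : nat -> V) (m : nat) :
  \sum_(0 <= i < m) (\sum_(0 <= j < i.+1) d j) *: (K i - K i.+1) =
  \sum_(0 <= i < m) d i *: K i - (\sum_(0 <= j < m) d j) *: K m.
Proof.
elim: m => [|m IHm]; first by rewrite !big_geq // scale0r subr0.
rewrite big_nat_recr //= IHm [\sum_(0 <= i < m.+1) d i *: K i]big_nat_recr //=.
rewrite scalerBr big_nat_recr //= [in X in _ + (X - _)]scalerDl.
rewrite -!addrA; congr (_ + _).
by rewrite !addrA addNr add0r.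
Qed.

Lemma simple_root_expand (t : star_kind) (n : nat) (v : evec n) :
  (1 <= n)%N -> const_tail t v ->
  v = \sum_(i < rank t n) simple_coef t v i *: simple_root t n i.+1.
Proof.
move=> n_ge1 vtail; have mB := rkm2_bounds t n_ge1.
rewrite -(big_mkord xpredT (fun i => simple_coef t v i *: simple_root t n i.+1)).
rewrite rankE !big_nat_recr //= simple_root_vec simple_root_spin.
rewrite /simple_coef !ltnn eqxx ltnNge leqnSn /= (gtn_eqF (leqnn _)).
rewrite big_nat_cond.
under eq_bigr => i /andP[/andP[_ lti] _].
  rewrite lti simple_root_lt // scalerBl -scaleNr; over.
rewrite -big_nat_cond big_split /= (abel_telescope _ (fun i => kvec n i.+1)).
set m := rkm2 t n in mB *; set q := halfdiff t v.
(* The correction by half the total sits on the last chain root alpha_(R-2) only. *)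
have -> : \sum_(0 <= i < m) - ((i.+1 == m)%:R * q) *: (kvec n i.+1 - kvec n i.+2)
   = - q *: (kvec n m - kvec n m.+1).
  case: m mB {q} (q) => // m _ q; rewrite big_nat_recr //= eqxx mul1r big_nat big1.
    by rewrite add0r.
  by move=> i lti; rewrite eqSS ltn_eqF // mul0r oppr0 scale0r.
have -> : \sum_(0 <= j < m) kdiff v j = 2 * q - kdiff v m.
  rewrite /q /halfdiff -/m big_nat_recr //=; by field.
apply: (etrans (evec_expand v)).
transitivity (\sum_(0 <= i < m.+1) kdiff v i *: kvec n i.+1 +
  kcoord (edim n) v *: \sum_(1 <= j < (edim n).+1) kvec n j); last first.
  rewrite big_nat_recr //=; apply/rowP=> j; rewrite !mxE; by field.
have -> : \sum_(0 <= i < m.+1) kdiff v i *: kvec n i.+1 =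
    \sum_(1 <= i < m.+2) (kcoord i v - kcoord (edim n) v) *: kvec n i.
  by rewrite big_add1.
rewrite scaler_sumr.
apply: evec_kcoordP => i iP; rewrite raddfD /= !kcoord_sum_kvec // !ltnS iP.
case/andP: iP => i_gt0 leiN; rewrite i_gt0 /=.
(* From index R on, the coordinate equals the last one, which the spinor alpha_R already
   supplies. *)
case: leqP => [_ | ltmi]; first by rewrite subrK.
by rewrite add0r (vtail i) // rankE ltmi.
Qed.

Lemma const_tail_span (t : star_kind) (n : nat) (v : evec n) :
  (1 <= n)%N -> const_tail t v -> v \in <<simple_roots t n>>%VS.
Proof.
move=> n_ge1 vtail; rewrite (simple_root_expand n_ge1 vtail).
apply: memv_suml => i _; apply/memvZ/memv_span/tnthP.
by exists i; rewrite tnth_mktuple.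
Qed.

(** Dimension count: by [const_tail_span] the R simple roots span the R independent vectors k_1,
    ..., k_(R-1) and k_R + ... + k_N. *)
Lemma simple_roots_free (t : star_kind) (n : nat) :
  (1 <= n)%N -> free (simple_roots t n).
Proof.
move=> n_ge1; have mB := rkm2_bounds t n_ge1; have rE := rankE t n.
pose w i := if (i < (rkm2 t n).+1)%N then kvec n i.+1
            else \sum_(rank t n <= j < (edim n).+1) 1 *: kvec n j.
pose Y := [tuple w i | i < rank t n].
have kcoord_w (i j : nat) : (i < rank t n)%N -> (j < rank t n)%N ->
    kcoord i.+1 (w j) = (i == j)%:R.
  rewrite /w => ltiR ltjR.
  have iN : (0 < i.+1 <= edim n)%N by lia.
  case: ifP => ltj; first by rewrite kcoord_kvec // eqSS.
  rewrite (kcoord_sum_kvec _ _ (fun=> 1)) //; congr (nat_of_bool _)%:R.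
  by lia.
have Yfree : free Y.
  apply/freeP => c /(congr1 (@kcoord n _)) c0 i.
  have := c0 i.+1; rewrite raddf0 linear_sum /= => <-.
  rewrite (bigD1 i) //= big1 => [|j neq_ji]; rewrite nth_mktuple kcoordZ kcoord_w ?ltn_ord //.
    by rewrite eqxx mulr1 addr0.
  by rewrite eq_sym val_eqE (negPf neq_ji) mulr0.
rewrite /free eqn_leq dim_span size_tuple /=.
have dimY : \dim <<Y>> = rank t n by rewrite (eqP Yfree) size_tuple.
rewrite -[X in (X <= _)%N]dimY; apply/dimvS/span_subvP => _ /tnthP[j ->].
rewrite tnth_mktuple; apply: const_tail_span => // i iR.
have ltjR := ltn_ord j.
rewrite /w; case: ifP => ltj.
  by rewrite !kcoord_kvec; [do 2 case: eqP => //; lia | lia..].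
rewrite !(kcoord_sum_kvec _ _ (fun=> 1)); [|lia..].
by congr (nat_of_bool _)%:R; lia.
Qed.

(* The integer span of the simple roots, described by coordinates. *)
Definition in_lattice (t : star_kind) (n : nat) (v : evec n) : Prop :=
  [/\ const_tail t v,
      forall i, (i < edim n)%N -> kdiff v i \is a Num.int,
      2 * kcoord (edim n) v \is a Num.int
    & (\sum_(1 <= i < (edim n).+1) kcoord i v) / 2 \is a Num.int].

Lemma coord_simple (t : star_kind) (n : nat) (v : evec n) (i : 'I_(rank t n)) :
  (1 <= n)%N -> const_tail t v ->
  coord (simple_roots t n) i v = simple_coef t v i.
Proof.
move=> n_ge1 vtail; rewrite {1}(simple_root_expand n_ge1 vtail).
under eq_bigr => j _ do
  rewrite -(nth_mktuple (fun j => simple_root t n j.+1) 0 j).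
by rewrite (coord_sum_free (fun j => simple_coef t v j)) ?simple_roots_free.
Qed.

(** Here N = 4(n+1) matters: subtracting the last coordinate x from all N coordinates changes half
    their sum by (n+1)(2x), an integer as soon as 2x is one. *)
Lemma halfdiffE (t : star_kind) (n : nat) (v : evec n) :
  (1 <= n)%N -> const_tail t v ->
  halfdiff t v = (\sum_(1 <= i < (edim n).+1) kcoord i v) / 2
                 - (2 * kcoord (edim n) v) *+ n.+1.
Proof.
move=> n_ge1 vtail; have mB := rkm2_bounds t n_ge1; have rE := rankE t n.
have -> : \sum_(1 <= i < (edim n).+1) kcoord i v =
          \sum_(0 <= i < edim n) kdiff v i + kcoord (edim n) v *+ edim n.
  rewrite big_add1 -{4}(subn0 (edim n)) -sumr_const_nat -big_split /=.
  by apply: eq_bigr => i _; rewrite subrK.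
rewrite (@big_cat_nat _ _ _ (rkm2 t n).+1) /=; [|lia..].
have -> : \sum_((rkm2 t n).+1 <= i < edim n) kdiff v i = 0.
  rewrite big_nat big1 // => i /andP[lei lti].
  by rewrite /kdiff (vtail i.+1) ?subrr //; lia.
rewrite addr0 /halfdiff.
have -> : kcoord (edim n) v *+ edim n = 4 * kcoord (edim n) v *+ n.+1.
  by rewrite -mulrnAr mulr_natl -mulrnA mulnC.
move: (\sum_(_ <= i < _) _) (kcoord _ v) => S x.
by rewrite -[4 * x *+ _]mulr_natr -[2 * x *+ _]mulr_natr; field.
Qed.

Lemma coord_int (t : star_kind) (n : nat) (v : evec n) (i : 'I_(rank t n)) :
  (1 <= n)%N -> in_lattice t v ->
  coord (simple_roots t n) i v \is a Num.int.
Proof.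
move=> n_ge1 [vtail vint v2 vhalf]; have mB := rkm2_bounds t n_ge1; have rE := rankE t n.
have hint : halfdiff t v \is a Num.int.
  by rewrite halfdiffE // rpredB ?rpredMn.
rewrite coord_simple // /simple_coef; case: ifP => [ltim|_].
  apply: rpredB; last by rewrite rpredM ?rpred_nat.
  rewrite big_nat; apply: rpred_sum => j ltj.
  by apply: vint; lia.
by case: ifP => _; rewrite ?rpredN.
Qed.

Lemma in_latticeN (t : star_kind) (n : nat) (v : evec n) :
  in_lattice t v -> in_lattice t (- v).
Proof.
case=> vtail vint v2 vhalf; split=> [i iR|i ltiN||].
- by rewrite !raddfN /= vtail.
- by rewrite /kdiff !raddfN /= -opprD rpredN vint.
- by rewrite raddfN mulrN rpredN.
by under eq_bigr do rewrite raddfN; rewrite sumrN mulNr rpredN.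
Qed.

(** * Generalized roots: lattice membership and length bound *)

Lemma pair_roots_ind (n m : nat) (P : evec n -> Prop) :
  (forall v, P v -> P (- v)) ->
  (forall i j, (0 < i < j)%N -> (j <= m)%N ->
     P (kvec n i + kvec n j) /\ P (kvec n i - kvec n j)) ->
  forall v, v \in pair_roots n m -> P v.
Proof.
move=> PN Pk v /flattenP[s /allpairsPdep[i [j [im jm ->]]]].
rewrite !mem_iota in im jm.
have [| |Pp Pm] := Pk i j; [lia | lia |].
rewrite !inE => /or4P[] /eqP-> //; last by rewrite -opprD; apply: PN.
by rewrite -[X in P X]opprK opprD opprK; apply: PN.
Qed.

Lemma mem_pair_roots (n m i j : nat) : (0 < i < j)%N -> (j <= m)%N ->
  {subset [:: kvec n i + kvec n j; kvec n i - kvec n j] <= pair_roots n m}.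
Proof.
move=> lt_ij lejm v vij; apply/flattenP.
exists [:: kvec n i + kvec n j; kvec n i - kvec n j;
           - kvec n i + kvec n j; - kvec n i - kvec n j].
  by apply/allpairsPdep; exists i, j; rewrite !mem_iota; split=> //; lia.
by move: vij; rewrite !inE => /orP[] ->; rewrite ?orbT.
Qed.

Lemma kcoord_spinor (n i : nat) (e : {ffun 'I_(edim n) -> bool})
    (lti : (i < edim n)%N) :
  kcoord i.+1 (spinor e) = (e (Ordinal lti))%:R - 2^-1.
Proof.
rewrite kcoordZ linear_sum (bigD1 (Ordinal lti)) //= big1 => [|j neq_j].
  by case: (e _); rewrite ?raddfN /= kcoord_kvec // eqxx /=; field.
have neq_ij : (i == j)%N = false by rewrite eq_sym; apply: negPf neq_j.
by case: ifP => _; rewrite ?raddfN /= kcoord_kvec ?eqSS ?neq_ij ?oppr0.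
Qed.

Lemma sum_kcoord_kvec (n i : nat) : (0 < i <= edim n)%N ->
  \sum_(1 <= l < (edim n).+1) kcoord l (kvec n i) = 1.
Proof.
move=> iP; rewrite (bigD1_seq i) ?iota_uniq ?mem_index_iota ?ltnS //= kcoord_kvec // eqxx.
rewrite big_seq_cond big1 ?addr0 // => j /andP[].
by rewrite mem_index_iota => jP neq_ji; rewrite kcoord_kvec // (negPf neq_ji).
Qed.

Lemma in_lattice_pair (t : star_kind) (n i j : nat) (c : rat) :
  (c == 1) || (c == -1) -> (0 < i < j)%N ->
  (j < rank t n)%N \/ (t = E8 /\ (j <= edim n)%N) ->
  in_lattice t (kvec n i + c *: kvec n j).
Proof.
move=> c1 lt_ij jP.
have le_jN : (j <= edim n)%N by move: jP; case: t => /=; rewrite /edim; lia.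
have c_int : c \is a Num.int by case/orP: c1 => /eqP->.
have vE l : (0 < l <= edim n)%N ->
    kcoord l (kvec n i + c *: kvec n j) = (l == i)%:R + c * (l == j)%:R.
  by move=> lP; rewrite raddfD /= kcoordZ !kcoord_kvec.
have v_int l : (0 < l <= edim n)%N -> kcoord l (kvec n i + c *: kvec n j) \is a Num.int.
  by move=> /vE->; rewrite rpredD ?rpredM ?rpred_nat.
have NP : (0 < edim n <= edim n)%N by rewrite /edim; lia.
split.
- move=> l lP; case: jP => [ltjR|[tE _]].
    by rewrite !vE ?gtn_eqF //; lia.
  by rewrite tE /= in lP; have -> : l = edim n by lia.
- by move=> l ltl; rewrite rpredB ?v_int.
- by rewrite rpredM ?v_int ?rpred_nat.
under eq_bigr do rewrite raddfD /= kcoordZ.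
rewrite big_split /= -mulr_sumr !sum_kcoord_kvec; [|lia..].
by case/orP: c1 => /eqP->.
Qed.

Lemma in_lattice_tail_pair (n : nat) :
  in_lattice E7 (kvec n (edim n - 1) + kvec n (edim n)).
Proof.
have vE l : (0 < l <= edim n)%N ->
    kcoord l (kvec n (edim n - 1) + kvec n (edim n)) =
    (l == edim n - 1)%N%:R + (l == edim n)%:R.
  by move=> lP; rewrite raddfD /= !kcoord_kvec.
have v_int l : (0 < l <= edim n)%N ->
    kcoord l (kvec n (edim n - 1) + kvec n (edim n)) \is a Num.int.
  by move=> /vE->; rewrite rpredD ?rpred_nat.
have NP : (0 < edim n <= edim n)%N by rewrite /edim; lia.
have N4 : (4 <= edim n)%N by rewrite /edim; lia.
split.
- move=> l /= lP; rewrite !vE //; last by lia.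
  have /orP[/eqP->|/eqP->//] : (l == edim n - 1)%N || (l == edim n) by lia.
  have neN : (edim n - 1 == edim n)%N = false by lia.
  by rewrite (eq_sym (edim n)) neN !eqxx addrC.
- by move=> l ltl; rewrite rpredB ?v_int.
- by rewrite rpredM ?v_int ?rpred_nat.
under eq_bigr do rewrite raddfD /=.
by rewrite big_split /= !sum_kcoord_kvec //; lia.
Qed.

Lemma in_lattice_spinor (t : star_kind) (n : nat) (e : {ffun 'I_(edim n) -> bool}) :
  spin_signs t e -> in_lattice t (spinor e).
Proof.
case/andP=> e_even /forallP e_tail.
have lastP : ((edim n).-1 < edim n)%N by rewrite /edim; lia.
have lastE : (edim n).-1.+1 = edim n by rewrite /edim; lia.
split.
- move=> [|i] iP; first by rewrite rankE in iP.
  have lti : (i < edim n)%N by case/andP: iP.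
  rewrite -{1}lastE !kcoord_spinor.
  have /forallP/(_ (Ordinal lastP)) := e_tail (Ordinal lti).
  rewrite /= lastE; case/andP: iP => -> _.
  have -> : (rank t n <= edim n)%N by case: t {e_tail} => /=; lia.
  by move/eqP->.
- move=> i lti; rewrite /kdiff -{1}lastE !kcoord_spinor opprB addrA subrK.
  by rewrite rpredB ?rpred_nat.
- rewrite -{1}lastE kcoord_spinor mulrBr mulfV //.
  by rewrite rpredB ?rpredM ?rpred_nat.
(* Each coordinate is 1/2 or -1/2, so the sum is the number of + signs minus N/2; both are even. *)
have -> : \sum_(1 <= i < (edim n).+1) kcoord i (spinor e) =
          #|[set i | e i]|%:R - 2 * n.+1%:R.
  rewrite big_add1 /= big_mkord.
  under eq_bigr => i _ do rewrite (kcoord_spinor _ (ltn_ord i)).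
  rewrite sumrB sumr_const card_ord -sum1_card natr_sum [in RHS]big_mkcond /=.
  congr (_ - _).
    apply: eq_bigr => i _; rewrite inE.
    have -> : Ordinal (ltn_ord i) = i by apply: val_inj.
    by case: (e i).
  by rewrite -[_ *+ edim n]mulr_natl natrM; field.
rewrite -(even_halfK e_even) -muln2 natrM mulrBl mulfK // mulrAC mulfV // mul1r.
by rewrite rpredB ?rpred_nat.
Qed.

Definition sqnorm3 (n : nat) (v : evec n) : rat :=
  kcoord 1 v ^+ 2 + kcoord 2 v ^+ 2 + kcoord 3 v ^+ 2.

Lemma sqnorm3N (n : nat) (v : evec n) : sqnorm3 (- v) = sqnorm3 v.
Proof. by rewrite /sqnorm3 !raddfN /= !sqrrN. Qed.

Lemma sqnorm3_pair (n i j : nat) (c : rat) :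
  (c == 1) || (c == -1) -> (0 < i < j)%N -> sqnorm3 (kvec n i + c *: kvec n j) <= 2.
Proof.
have N4 : (4 <= edim n)%N by rewrite /edim; lia.
move=> c1 lt_ij; rewrite /sqnorm3 !raddfD /= !kcoordZ !kcoord_kvec; [|lia..].
case: i lt_ij => [|[|[|[|i]]]] //; case: j => [|[|[|[|j]]]] //= _;
  by case/orP: c1 => /eqP->; rewrite /= ?eqSS; lra.
Qed.

(** Case analysis shared by the lattice and length arguments, whose properties are invariant under
    negation. The pairs of E6 and E7 stop at index R - 1; only those of E8 reach k_N. *)
Lemma Phi_ind (t : star_kind) (n : nat) (P : evec n -> Prop) :
  (forall v, P v -> P (- v)) ->
  (forall i j c, (c == 1) || (c == -1) -> (0 < i < j)%N ->
     (j < rank t n)%N \/ (t = E8 /\ (j <= edim n)%N) -> P (kvec n i + c *: kvec n j)) ->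
  (t = E7 -> P (kvec n (edim n - 1) + kvec n (edim n))) ->
  (forall e, spin_signs t e -> P (spinor e)) ->
  forall v, v \in Phi t n -> P v.
Proof.
move=> PN Pk P7 Ps v; rewrite mem_cat => /orP[|/mapP[e]]; last first.
  by rewrite mem_filter => /andP[/Ps Pe _ ->].
have Ppair m : ((m < rank t n)%N \/ (t = E8 /\ (m <= edim n)%N)) ->
    forall v, v \in pair_roots n m -> P v.
  move=> mP; apply: pair_roots_ind => // i j lt_ij lejm.
  have jP : (j < rank t n)%N \/ (t = E8 /\ (j <= edim n)%N).
    by case: mP => [ltm|[-> lem]]; [left | right; split=> //]; lia.
  split; first by rewrite -[kvec n j]scale1r; apply: Pk.
  by rewrite -scaleN1r; apply: Pk.
case: t Ps P7 Pk Ppair => Ps P7 Pk Ppair /=.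
- by apply: Ppair; left; rewrite /= /edim; lia.
- rewrite mem_cat => /orP[|].
    by apply: Ppair; left; rewrite /= /edim; lia.
  by rewrite !inE => /orP[]/eqP->; rewrite -/(edim n); [|apply: PN]; apply: P7.
by apply: Ppair; right.
Qed.

Lemma in_lattice_Phi (t : star_kind) (n : nat) (v : evec n) :
  v \in Phi t n -> in_lattice t v.
Proof.
move: v; apply: Phi_ind; first exact: in_latticeN.
- by move=> i j c; apply: in_lattice_pair.
- by move=> ->; apply: in_lattice_tail_pair.
exact: in_lattice_spinor.
Qed.

Lemma sqnorm3_Phi (t : star_kind) (n : nat) (v : evec n) : (1 <= n)%N ->
  v \in Phi t n -> sqnorm3 v <= 2.
Proof.
move=> n_ge1; move: v; apply: Phi_ind => [v|i j c c1 ij _|_|e _].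
- by rewrite sqnorm3N.
- exact: sqnorm3_pair.
- by rewrite -[kvec n (edim n)]scale1r sqnorm3_pair // /edim; lia.
have N1 : (0 < edim n)%N by [].
have N2 : (1 < edim n)%N by rewrite /edim; lia.
have N3 : (2 < edim n)%N by rewrite /edim; lia.
rewrite /sqnorm3 (kcoord_spinor _ N1) (kcoord_spinor _ N2) (kcoord_spinor _ N3).
by do 3 case: (e _); rewrite /=; lra.
Qed.

(** * Types of roots, tips and axes *)

Lemma star_typeE (n : nat) (v : evec n) :
  star_type v = (kcoord 1 v - kcoord 2 v, kcoord 1 v + kcoord 2 v - 2 * kcoord 3 v).
Proof.
have dotDr (u w : evec n) : dot v (u + w) = dot v u + dot v w.
  by rewrite /dot -big_split /=; apply: eq_bigr => i _; rewrite mxE mulrDr.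
have dotNr (u : evec n) c : dot v (c *: u) = c * dot v u.
  by rewrite /dot mulr_sumr; apply: eq_bigr => i _; rewrite mxE mulrCA.
by rewrite /star_type !dotDr -!scaleN1r !dotNr !mulN1r.
Qed.

Lemma star_type_is_zmod_morphism (n : nat) : zmod_morphism (@star_type n).
Proof.
by move=> u v; rewrite !star_typeE !raddfB /=; congr pair; rewrite /=; ring.
Qed.

HB.instance Definition _ (n : nat) :=
  GRing.isZmodMorphism.Build (evec n) (rat * rat)%type (@star_type n)
    (@star_type_is_zmod_morphism n).

Lemma star_type_bound (t : star_kind) (n : nat) (v : evec n) : (1 <= n)%N ->
  v \in Phi t n -> (star_type v).1 ^+ 2 / 2 + (star_type v).2 ^+ 2 / 6 <= 2.
Proof.
move=> n_ge1 /(sqnorm3_Phi n_ge1); rewrite star_typeE /sqnorm3 /=.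
set a := kcoord 1 v; set b := kcoord 2 v; set c := kcoord 3 v => le2.
apply: le_trans le2; rewrite -subr_ge0.
(* The difference is the squared length of the component along k_1+k_2+k_3. *)
have -> : a ^+ 2 + b ^+ 2 + c ^+ 2 -
    ((a - b) ^+ 2 / 2 + (a + b - 2 * c) ^+ 2 / 6) = (a + b + c) ^+ 2 / 3 by field.
by rewrite divr_ge0 ?sqr_ge0.
Qed.

(** One case per pair of opposite tips, matching the branches of [axis]. *)
Lemma tipsP (r s : rat) : (r, s) \in tips ->
  [\/ (r == 0) && ((s == 2) || (s == -2)) ,
      (s == r) && ((r == 1) || (r == -1)) | (s == - r) && ((r == 1) || (r == -1))].
Proof.
by rewrite !inE => /or4P[/eqP[-> ->]|/eqP[-> ->]|/eqP[-> ->]|/or3P[]/eqP[-> ->]];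
  do [by apply: Or31 | by apply: Or32 | by apply: Or33].
Qed.

Lemma star_type_neq_double_tip (t : star_kind) (n : nat) (r s : rat)
    (v : evec n) :
  (1 <= n)%N -> (r, s) \in tips -> v \in Phi t n -> star_type v != (r *+ 2, s *+ 2).
Proof.
move=> n_ge1 rs_tip /(star_type_bound n_ge1) le2; apply/eqP=> vE.
rewrite vE /= in le2.
case/tipsP: rs_tip => /andP[/eqP sE /orP[]/eqP rE]; move: le2; rewrite sE rE; lra.
Qed.

(** Treats the three axes uniformly. In the last clause y is the component along the axis and z the
    one along k_1+k_2+k_3; no third component survives, since the type of v is proportional to the
    tip. *)
Lemma axisP (n : nat) (r s : rat) : (r, s) \in tips ->
  exists a b c : int,
  [/\ axis n r s = a%:~R *: kvec n 1 + b%:~R *: kvec n 2 + c%:~R *: kvec n 3,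
      a + b + c = 0, a ^+ 2 + b ^+ 2 + c ^+ 2 = 6
    & forall x (v : evec n), star_type v = (x * r, x * s) ->
      exists y z, [/\ kcoord 1 v = y * a%:~R + z, kcoord 2 v = y * b%:~R + z
                    & kcoord 3 v = y * c%:~R + z]].
Proof.
case/tipsP=> /andP[/eqP rE sE]; rewrite /axis.
- exists 1, 1, (-2); rewrite rE eqxx; split=> //.
    by apply/rowP=> j; rewrite !mxE; ring.
  move=> x v; rewrite star_typeE => -[e1 e2].
  (* Here y is (v, axis) / 6, where 6 is the squared length of the axis; likewise in the other two
     cases. *)
  exists (x * s / 6), (kcoord 1 v - x * s / 6).
  by split; lra.
- have r0 : (r == 0) = false by case/orP: sE => /eqP->.
  exists 2, (-1), (-1); rewrite r0 rE eqxx; split=> //.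
    by apply/rowP=> j; rewrite !mxE; ring.
  move=> x v; rewrite star_typeE => -[e1 e2].
  exists (x * r / 3), (kcoord 1 v - 2 * (x * r / 3)).
  by split; lra.
have [r0 rs] : (r == 0) = false /\ (r == s) = false.
  by rewrite rE; case/orP: sE => /eqP->.
exists (-1), 2, (-1); rewrite r0 rs; split=> //.
  by apply/rowP=> j; rewrite !mxE; ring.
move=> x v; rewrite star_typeE rE => -[e1 e2].
exists (- (x * r / 3)), (kcoord 1 v - x * r / 3).
by split; lra.
Qed.

Lemma in_lattice_axis (t : star_kind) (n : nat) (r s : rat) :
  (1 <= n)%N -> (r, s) \in tips -> in_lattice t (axis n r s).
Proof.
move=> n_ge1 /(axisP n)[a [b [c [-> abc0 _ _]]]].
have N8 : (8 <= edim n)%N by rewrite /edim; lia.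
set v := (X in in_lattice t X).
have vE l : (0 < l <= edim n)%N -> kcoord l v =
    a%:~R * (l == 1)%N%:R + b%:~R * (l == 2)%N%:R + c%:~R * (l == 3)%N%:R.
  by move=> lP; rewrite /v !raddfD /= !kcoordZ !kcoord_kvec.
have v_int l : (0 < l <= edim n)%N -> kcoord l v \is a Num.int.
  by move=> /vE->; rewrite !rpredD ?rpredM ?rpred_nat ?rpred_int.
have v0 l : (4 <= l <= edim n)%N -> kcoord l v = 0.
  move=> lP; rewrite vE; last by lia.
  by rewrite !gtn_eqF ?mulr0 ?addr0 //; lia.
have R4 : (4 <= rank t n)%N by case: t => /=; lia.
split.
- by move=> l lP; rewrite !v0 //; lia.
- by move=> l ltl; rewrite rpredB ?v_int //; lia.
- by rewrite rpredM ?v_int ?rpred_nat //; lia.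
under eq_bigr do rewrite /v !raddfD /= !kcoordZ.
rewrite !big_split /= -!mulr_sumr !sum_kcoord_kvec; [|lia..].
by rewrite !mulr1 -!intrD abc0 mul0r.
Qed.

(** * The rational span of the roots of type (0, 0) *)

Definition type0_span (t : star_kind) (n : nat) : {vspace evec n} :=
  <<[seq v <- Phi t n | star_type v == (0, 0)%R]>>%VS.

Lemma mem_type0_span (t : star_kind) (n : nat) (v : evec n) :
  v \in Phi t n -> star_type v = (0, 0) -> v \in type0_span t n.
Proof. by move=> vP v0; rewrite memv_span // mem_filter v0 eqxx. Qed.

(** Half the sum and half the difference of k_j + k_l and k_j - k_l, of type (0, 0) for 4 <= j < l.
    A partner index below R exists because n >= 1 gives R >= 6. *)
Lemma kvec_type0 (t : star_kind) (n i : nat) : (1 <= n)%N ->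
  (4 <= i < rank t n)%N -> kvec n i \in type0_span t n.
Proof.
move=> n_ge1 iP.
have N8 : (8 <= edim n)%N by rewrite /edim; lia.
have pairP j l : (4 <= j < l)%N -> (l < rank t n)%N ->
    kvec n j \in type0_span t n /\ kvec n l \in type0_span t n.
  move=> jP lP.
  have inPhi v : v \in [:: kvec n j + kvec n l; kvec n j - kvec n l] ->
      v \in type0_span t n.
    move=> vjl; apply: mem_type0_span.
      rewrite mem_cat; apply/orP; left.
      case: t lP {iP} => /= lP; rewrite ?mem_cat;
        rewrite (@mem_pair_roots n _ j l _ _ v vjl) //; lia.
    rewrite star_typeE; move: vjl; rewrite !inE => /orP[]/eqP->;
      rewrite ?raddfB ?raddfD /= !kcoord_kvec; (try lia);
      by rewrite !ltn_eqF ?subr0 ?addr0 ?mulr0 ?subr0 //; lia.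
  have Wp := inPhi _ (mem_head _ _).
  have Wm : kvec n j - kvec n l \in type0_span t n by apply: inPhi; rewrite !inE eqxx orbT.
  split.
    have -> : kvec n j = 2^-1 *: (kvec n j + kvec n l) + 2^-1 *: (kvec n j - kvec n l).
      by apply/rowP=> o; rewrite !mxE; field.
    by rewrite rpredD // rpredZ.
  have -> : kvec n l = 2^-1 *: (kvec n j + kvec n l) - 2^-1 *: (kvec n j - kvec n l).
    by apply/rowP=> o; rewrite !mxE; field.
  by rewrite rpredB // rpredZ.
have R6 : (6 <= rank t n)%N by case: t {iP pairP} => /=; lia.
have [->|ne_i4] := eqVneq i 4; first by have [] := pairP 4 5 => //; lia.
by have [] := pairP 4 i => //; lia.
Qed.

Lemma spinor_type0 (t : star_kind) (n : nat) (e : {ffun 'I_(edim n) -> bool}) :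
  (1 <= n)%N -> spin_signs t e ->
  (forall i j : 'I_(edim n), (i < 3)%N -> (j < 3)%N -> e i = e j) ->
  spinor e \in type0_span t n.
Proof.
move=> n_ge1 eP e3.
have N1 : (0 < edim n)%N by rewrite /edim; lia.
have N2 : (1 < edim n)%N by rewrite /edim; lia.
have N3 : (2 < edim n)%N by rewrite /edim; lia.
apply: mem_type0_span.
  by rewrite mem_cat map_f ?orbT // mem_filter eP mem_enum.
rewrite star_typeE (kcoord_spinor _ N1) (kcoord_spinor _ N2) (kcoord_spinor _ N3).
rewrite (e3 (Ordinal N2) (Ordinal N1)) // (e3 (Ordinal N3) (Ordinal N1)) //.
by congr pair; ring.
Qed.

Definition minus_spinor (n : nat) : evec n := spinor [ffun i => false].

Lemma kcoord_minus_spinor (n i : nat) : (0 < i <= edim n)%N ->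
  kcoord i (minus_spinor n) = - 2^-1.
Proof. by case: i => // i lti; rewrite (kcoord_spinor _ lti) ffunE sub0r. Qed.

Lemma minus_spinor_type0 (t : star_kind) (n : nat) : (1 <= n)%N ->
  minus_spinor n \in type0_span t n.
Proof.
move=> n_ge1; apply: spinor_type0 => // [|i j _ _]; last by rewrite !ffunE.
apply/andP; split.
  by rewrite eq_card0 // => i; rewrite !inE ffunE.
by apply/forallP=> i; apply/forallP=> j; rewrite !ffunE eqxx implybT.
Qed.

Lemma sum_kvec123_type0 (t : star_kind) (n : nat) : (1 <= n)%N ->
  kvec n 1 + kvec n 2 + kvec n 3 \in type0_span t n.
Proof.
move=> n_ge1.
have N8 : (8 <= edim n)%N by rewrite /edim; lia.
have R6 : (6 <= rank t n)%N by case: t => /=; lia.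
(* Plus signs exactly on k_1, ..., k_4: an even number, away from the tail. Subtracting the
   all-minus spinor leaves k_1+k_2+k_3+k_4. *)
pose e := [ffun i : 'I_(edim n) => (i < 4)%N].
have eP : spin_signs t e.
  apply/andP; split; last first.
    apply/forallP=> i; apply/forallP=> j; apply/implyP=> /andP[iR jR].
    by rewrite !ffunE; apply/eqP; lia.
  have N4 : (4 <= edim n)%N by lia.
  rewrite -sum1_card; under eq_bigl do rewrite inE ffunE.
  by rewrite (big_ord_narrow N4) sum1_card card_ord.
have eW : spinor e \in type0_span t n.
  by apply: spinor_type0 => // i j i3 j3; rewrite !ffunE; lia.
have -> : kvec n 1 + kvec n 2 + kvec n 3 =
    spinor e - minus_spinor n - kvec n 4.
  apply: evec_kcoordP => -[//|i] lti.
  rewrite !raddfB !raddfD /= kcoord_minus_spinor // (kcoord_spinor _ lti) ffunE.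
  rewrite !kcoord_kvec //; case: i lti => [|[|[|[|i]]]] lti //=; field.
apply: rpredB; last by rewrite kvec_type0 //; lia.
by rewrite rpredB // minus_spinor_type0.
Qed.

Lemma tip_mem_span (t : star_kind) (n : nat) (r s x : rat) (v : evec n) :
  (1 <= n)%N -> (r, s) \in tips -> const_tail t v -> star_type v = (x * r, x * s) ->
  v \in (type0_span t n + <[axis n r s]>)%VS.
Proof.
move=> n_ge1.
have N8 : (8 <= edim n)%N by rewrite /edim; lia.
have R6 : (6 <= rank t n <= edim n)%N by case: t => /=; lia.
move=> /(axisP n)[a [b [c [-> _ _ vP]]]] vtail /vP[y [z [v1 v2 v3]]].
set w := a%:~R *: _ + _ + _; set vN := kcoord (edim n) v.
(* The spinor term puts [vN] in every coordinate, which settles the tail; indices 4 to R - 1 are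
   corrected one by one, and the first three through the axis and k_1+k_2+k_3. *)
have -> : v = (z - vN) *: (kvec n 1 + kvec n 2 + kvec n 3) +
    \sum_(4 <= i < rank t n) (kcoord i v - vN) *: kvec n i -
    (2 * vN) *: minus_spinor n + y *: w.
  apply: evec_kcoordP => l lP.
  rewrite /w !(kcoord_minus_spinor lP, kcoordE).
  rewrite kcoord_sum_kvec // !kcoord_kvec //.
  have [l3|l_gt3] := leqP l 3.
    have {l3} : [|| l == 1, l == 2 | l == 3]%N by lia.
    by case/or3P => /eqP->; rewrite ?v1 ?v2 ?v3 /=; field.
  rewrite !gtn_eqF; [|lia..]; case: ltnP => [ltlR|leRl] /=; first by field.
  by rewrite (vtail l) ?leRl -/vN; [field | lia].
apply: memv_add; last by rewrite memvZ // memv_line.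
apply: rpredB; last by rewrite memvZ // minus_spinor_type0.
apply: rpredD; first by rewrite memvZ // sum_kvec123_type0.
rewrite big_nat; apply: rpred_sum => i iP.
by rewrite memvZ // kvec_type0.
Qed.

(** * Transfer of rational relations to Cartan elements *)

Lemma intr_eq0_pchar0 (F : fieldType) (F0 : [pchar F] =i pred0) (z : int) :
  (z%:~R == 0 :> F) = (z == 0).
Proof.
have nat0 := (pcharf0P F).1 F0.
by case: z => m; rewrite ?NegzE ?rmorphN ?oppr_eq0 /= nat0.
Qed.

(** In characteristic 0 any fraction representing x computes [ratr x], not only the reduced one;
    additivity and multiplicativity follow. *)
Lemma ratr_frac (F : fieldType) (F0 : [pchar F] =i pred0) (x : rat) (a b : int) :
  b != 0 -> x * b%:~R = a%:~R -> ratr x = a%:~R / b%:~R :> F.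
Proof.
move=> b0 xb; have dx0 : denq x != 0 by rewrite denq_eq0.
apply/eqP; rewrite /ratr eqr_div ?intr_eq0_pchar0 // -!intrM; apply/eqP; congr (_%:~R).
apply/eqP; rewrite -(eqr_int rat) !intrM -xb numqE; apply/eqP; ring.
Qed.

Lemma ratrD_pchar0 (F : fieldType) (F0 : [pchar F] =i pred0) :
  {morph @ratr F : x y / x + y}.
Proof.
move=> x y; have dx0 : denq x != 0 by rewrite denq_eq0.
have dy0 : denq y != 0 by rewrite denq_eq0.
rewrite (@ratr_frac F F0 _ (numq x * denq y + numq y * denq x) (denq x * denq y)).
- by rewrite /ratr !intrM intrD !intrM; field; rewrite !intr_eq0_pchar0 ?dx0 ?dy0.
- by rewrite mulf_neq0.
by rewrite intrD !intrM !numqE; ring.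
Qed.

Lemma ratrM_pchar0 (F : fieldType) (F0 : [pchar F] =i pred0) :
  {morph @ratr F : x y / x * y}.
Proof.
move=> x y; have dx0 : denq x != 0 by rewrite denq_eq0.
have dy0 : denq y != 0 by rewrite denq_eq0.
rewrite (@ratr_frac F F0 _ (numq x * numq y) (denq x * denq y)).
- by rewrite /ratr !intrM; field; rewrite !intr_eq0_pchar0 ?dx0 ?dy0.
- by rewrite mulf_neq0.
by rewrite !intrM !numqE; ring.
Qed.

(* Extends [hvec] from the lattice to its rational span. *)
Definition hrat (F : fieldType) (t : star_kind) (n : nat) (v : evec n) :
    magic_star F t n :=
  \sum_i ratr (coord (simple_roots t n) i v) *: hgen F i.

(** [hvec] keeps only numerators of coordinates, which loses nothing on the lattice. *)
Lemma hrat_hvec (F : fieldType) (t : star_kind) (n : nat) (v : evec n) :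
  (1 <= n)%N -> in_lattice t v -> hvec F t v = hrat F t v.
Proof.
move=> n_ge1 vL; apply: eq_bigr => i _.
by rewrite -[in RHS](numqK (coord_int i n_ge1 vL)) ratr_int.
Qed.

Lemma hrat_linear_sum (F : fieldType) (F0 : [pchar F] =i pred0) (t : star_kind)
    (n m : nat) (c : 'I_m -> rat) (v : 'I_m -> evec n) :
  hrat F t (\sum_i c i *: v i) = \sum_i ratr (c i) *: hrat F t (v i).
Proof.
elim/big_rec2: _ => [|i y x _ <-].
  by rewrite /hrat big1 // => i _; rewrite raddf0 (ratr_nat F 0) scale0r.
rewrite /hrat scaler_sumr -big_split; apply: eq_bigr => j _ /=.
by rewrite linearP /= ratrD_pchar0 // ratrM_pchar0 // scalerDl scalerA.
Qed.

Lemma hrat_span (F : fieldType) (F0 : [pchar F] =i pred0) (t : star_kind)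
    (n : nat) (X : seq (evec n)) (W : {vspace magic_star F t n}) (v : evec n) :
  (forall x, x \in X -> hrat F t x \in W) -> v \in <<X>>%VS -> hrat F t v \in W.
Proof.
move=> XW /(coord_span (X := in_tuple X)) ->; rewrite hrat_linear_sum //.
by apply: memv_suml => i _; rewrite memvZ // XW // mem_nth.
Qed.

(** The functional h_v -> (v, w), zero on every x_alpha; with w the axis it separates C from g_0. *)
Definition cartan_dot (F : fieldType) (t : star_kind) (n : nat) (w : evec n)
    (u : magic_star F t n) : F^o :=
  \sum_i ratr (dot (tnth (simple_roots t n) i) w) * u (inl i).

Lemma cartan_dot_is_linear (F : fieldType) (t : star_kind) (n : nat) (w : evec n) :
  linear (@cartan_dot F t n w).
Proof.
move=> c u v; rewrite /cartan_dot scaler_sumr -big_split /=.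
by apply: eq_bigr => i _; rewrite !ffunE mulrDr [in RHS]/GRing.scale /= mulrCA.
Qed.

HB.instance Definition _ (F : fieldType) (t : star_kind) (n : nat) (w : evec n) :=
  GRing.isLinear.Build F (magic_star F t n) F^o _ (@cartan_dot F t n w)
    (@cartan_dot_is_linear F t n w).

Lemma cartan_dot_hvec (F : fieldType) (F0 : [pchar F] =i pred0) (t : star_kind)
    (n : nat) (v w : evec n) : (1 <= n)%N -> in_lattice t v ->
  cartan_dot w (hvec F t v) = ratr (dot v w).
Proof.
move=> n_ge1 vL; have [vtail _ _ _] := vL.
rewrite {2}(coord_span (const_tail_span n_ge1 vtail)) hrat_hvec //.
have -> : dot (\sum_i coord (simple_roots t n) i v *: (simple_roots t n)`_i) w =
    \sum_i coord (simple_roots t n) i v * dot (tnth (simple_roots t n) i) w.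
  rewrite /dot; under [RHS]eq_bigr do rewrite mulr_sumr.
  rewrite exchange_big /=; apply: eq_bigr => j _.
  rewrite summxE mulr_suml; apply: eq_bigr => i _.
  by rewrite mxE (tnth_nth 0) mulrA.
rewrite (big_morph _ (ratrD_pchar0 F0) (ratr_nat F 0)) /cartan_dot.
apply: eq_bigr => i _; rewrite ratrM_pchar0 // mulrC; congr (_ * _).
rewrite /hrat sum_ffunE (bigD1 i) //= big1 ?addr0 => [|j neq_ji].
  by rewrite !ffunE eqxx [LHS]mulr1.
by rewrite !ffunE (inj_eq inl_inj) eq_sym (negPf neq_ji) [LHS]mulr0.
Qed.

(** * Supports of the pieces and the bracket criterion *)

Lemma hvec_inr (F : fieldType) (t : star_kind) (n : nat) (v : evec n) a :
  hvec F t v (inr a) = 0.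
Proof.
rewrite /hvec sum_ffunE big1 // => i _.
by rewrite !ffunE [LHS]mulr0.
Qed.

Lemma span_vanish (F : fieldType) (T : finType) (X : seq {ffun T -> F^o})
    (u : {ffun T -> F^o}) (b : T) :
  (forall x, x \in X -> x b = 0) -> u \in <<X>>%VS -> u b = 0.
Proof.
move=> Xb /(coord_span (X := in_tuple X)) ->; rewrite sum_ffunE big1 // => i _.
by rewrite ffunE Xb ?mem_nth // [LHS]mulr0.
Qed.

Lemma mem_roots_of_type (t : star_kind) (n : nat) (r s : rat) (a : gen_root t n) :
  (a \in roots_of_type t n r s) = (star_type (val a) == (r, s)).
Proof. by rewrite mem_filter mem_enum andbT. Qed.

(** Homogeneity of the root coordinates only; Cartan coordinates stay free, and [cartan_free]
    excludes them where the type is nonzero. *)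
Definition root_support (F : fieldType) (t : star_kind) (n : nat)
    (p : rat * rat) (U : {vspace magic_star F t n}) : Prop :=
  forall u a, u \in U -> u (inr a) != 0 -> star_type (val a) = p.

Definition cartan_free (F : fieldType) (t : star_kind) (n : nat)
    (U : {vspace magic_star F t n}) : Prop :=
  forall u i, u \in U -> u (inl i) = 0.

Lemma tip_root_support (F : fieldType) (t : star_kind) (n : nat) (r s : rat) :
  root_support (r, s) (tip_space F t n r s).
Proof.
move=> u a uT; apply: contra_neq_eq => neq_a; apply: span_vanish uT => _ /mapP[b bT ->].
rewrite !ffunE (inj_eq inr_inj); case: eqP => // eq_ab.
by move: bT; rewrite mem_roots_of_type -eq_ab (negPf neq_a).
Qed.

Lemma tip_cartan_free (F : fieldType) (t : star_kind) (n : nat) (r s : rat) :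
  cartan_free (tip_space F t n r s).
Proof.
by move=> u i; apply: span_vanish => _ /mapP[b _ ->]; rewrite !ffunE.
Qed.

Lemma center_root_support (F : fieldType) (t : star_kind) (n : nat) :
  root_support (0, 0) (center_space F t n).
Proof.
move=> u a uC; apply: contra_neq_eq => neq_a; apply: span_vanish uC => x.
rewrite mem_cat => /orP[]/mapP[b bT ->]; last exact: hvec_inr.
rewrite !ffunE (inj_eq inr_inj); case: eqP => // eq_ab.
by move: bT; rewrite mem_roots_of_type -eq_ab (negPf neq_a).
Qed.

Lemma add_axis_root_support (F : fieldType) (t : star_kind) (n : nat) (r s : rat) :
  root_support (0, 0) (center_space F t n + axis_space F t n r s)%VS.
Proof.
move=> u a /memv_addP[v vC [_ /vlineP[k ->] ->]].
by rewrite !ffunE hvec_inr [_ *: 0]mulr0 addr0; apply: center_root_support.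
Qed.

Lemma tip_center_subv (F : fieldType) (t : star_kind) (n : nat) :
  (tip_space F t n 0 0 <= center_space F t n)%VS.
Proof. by rewrite /center_space span_cat addvSl. Qed.

Lemma hvec_center (F : fieldType) (t : star_kind) (n : nat) (a : gen_root t n) :
  star_type (val a) = (0, 0) -> hvec F t (val a) \in center_space F t n.
Proof.
move=> a0; rewrite memv_span // mem_cat; apply/orP; right.
by apply: map_f; rewrite mem_roots_of_type a0.
Qed.

Lemma xgen_tip (F : fieldType) (t : star_kind) (n : nat) (a : gen_root t n)
    (p : rat * rat) : star_type (val a) = p -> xgen F a \in tip_space F t n p.1 p.2.
Proof.
by move=> ap; rewrite memv_span // map_f // mem_roots_of_type ap -surjective_pairing.
Qed.

(** Checked on pairs of basis elements that occur in u and v. An h_i can occur only in type 0, so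
    multiplying by it keeps the type p + q; two root vectors give type p + q by additivity, or
    h_alpha when the roots are opposite. *)
Lemma bracket_in_type (F : fieldType) (t : star_kind) (n : nat) (p q : rat * rat)
    (U V W : {vspace magic_star F t n}) :
  root_support p U -> root_support q V ->
  (p != 0 -> cartan_free U) -> (q != 0 -> cartan_free V) ->
  (tip_space F t n (p + q)%R.1 (p + q)%R.2 <= W)%VS ->
  (forall a : gen_root t n, star_type (val a) = p -> q = - p ->
     hvec F t (val a) \in W) ->
  bracket_in U V W.
Proof.
move=> suppU suppV freeU freeV tipW hvecW u v uU vV.
apply: memv_suml => b _; apply: memv_suml => c _.
have [->|ub0] := eqVneq (u b) 0; first by rewrite mul0r scale0r mem0v.
have [->|vc0] := eqVneq (v c) 0; first by rewrite mulr0 scale0r mem0v.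
apply: memvZ; case: b c ub0 vc0 => [i|a] [j|a'] ub0 vc0 /=.
- exact: mem0v.
- have q0 := suppV _ _ vV vc0.
  have p0 : p = 0.
    by apply: contraNeq ub0 => /freeU/(_ _ i uU) ->.
  by apply/memvZ/(subvP tipW); rewrite p0 add0r; apply: xgen_tip.
- have q0 : q = 0.
    by apply: contraNeq vc0 => /freeV/(_ _ j vV) ->.
  rewrite memvN; apply/memvZ/(subvP tipW); rewrite q0 addr0; apply: xgen_tip.
  exact: suppU uU ub0.
have ap := suppU _ _ uU ub0; have aq := suppV _ _ vV vc0.
case: eqP => [a'E|_].
  by rewrite memvN hvecW // -aq -ap -raddfN; congr star_type.
case: insubP => [a'' _ a''E|_]; last exact: mem0v.
by apply/memvZ/(subvP tipW)/xgen_tip; rewrite a''E -ap -aq -raddfD.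
Qed.

Lemma bracketDl (F : fieldType) (t : star_kind) (n : nat)
    (u u' v : magic_star F t n) : bracket (u + u') v = bracket u v + bracket u' v.
Proof.
rewrite /bracket -big_split; apply: eq_bigr => b _; rewrite -big_split.
by apply: eq_bigr => c _; rewrite ffunE mulrDl scalerDl.
Qed.

Lemma bracketDr (F : fieldType) (t : star_kind) (n : nat)
    (u v v' : magic_star F t n) : bracket u (v + v') = bracket u v + bracket u v'.
Proof.
rewrite /bracket -big_split; apply: eq_bigr => b _; rewrite -big_split.
by apply: eq_bigr => c _; rewrite ffunE mulrDr scalerDl.
Qed.

(** * The grading and the directness of the sum *)

Lemma three_graded_subalgebra (F : fieldType) (t : star_kind) (n : nat)
    (A : {vspace magic_star F t n}) (g : int -> {vspace magic_star F t n}) :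
  three_graded A g -> subalgebra A.
Proof.
case=> -> _ g0 g_bracket.
have subA k : (g k <= g (-1)%R + g 0%R + g 1%R)%VS.
  have [/g0->|le1] := ltrP 1 `|k|; first exact: sub0v.
  have : [|| k == -1, k == 0 | k == 1] by lia.
  case/or3P=> /eqP->.
  - by rewrite -addvA addvSl.
  - by rewrite (addvC (g _)) -addvA addvSl.
  by rewrite addvSr.
have br i j u v : u \in g i -> v \in g j -> `|i| <= 1 -> `|j| <= 1 ->
    bracket u v \in (g (-1)%R + g 0%R + g 1%R)%VS.
  by move=> ui vj i1 j1; apply: (subvP (subA (i + j))); apply: g_bracket.
move=> u v /memv_addP[_ /memv_addP[u1 u1P [u2 u2P ->]] [u3 u3P ->]].
move=> /memv_addP[_ /memv_addP[v1 v1P [v2 v2P ->]] [v3 v3P ->]].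
rewrite !bracketDl !bracketDr.
by repeat (apply: rpredD); (eapply br; [eassumption | eassumption | | ]).
Qed.

(** The inclusion that types alone do not decide, obtained from [tip_mem_span] through [hrat_span].
    The factor x lets one statement serve the center and both tips. *)
Lemma hvec_tip (F : fieldType) (F0 : [pchar F] =i pred0) (t : star_kind) (n : nat)
    (r s x : rat) (a : gen_root t n) : (1 <= n)%N -> (r, s) \in tips ->
  star_type (val a) = (x * r, x * s) ->
  hvec F t (val a) \in (center_space F t n + axis_space F t n r s)%VS.
Proof.
move=> n_ge1 rs_tip ax; have aL := in_lattice_Phi (valP a); have [atail _ _ _] := aL.
have := tip_mem_span n_ge1 rs_tip atail ax.
rewrite hrat_hvec // /type0_span -span_seq1 -span_cat; apply: hrat_span => // v.
rewrite mem_cat mem_seq1 => /orP[|/eqP->].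
  rewrite mem_filter => /andP[/eqP v0 vPhi]; rewrite -hrat_hvec //; last first.
    exact: in_lattice_Phi vPhi.
  by apply: (subvP (addvSl _ _)); apply: (@hvec_center F t n (SeqSub vPhi)).
rewrite -hrat_hvec //; last exact: in_lattice_axis.
by apply: (subvP (addvSr _ _)); rewrite memv_line.
Qed.

Lemma center_axis_direct (F : fieldType) (F0 : [pchar F] =i pred0) (t : star_kind)
    (n : nat) (r s : rat) : (1 <= n)%N -> (r, s) \in tips ->
  (center_space F t n :&: axis_space F t n r s = 0)%VS.
Proof.
move=> n_ge1 rs_tip; apply/eqP; rewrite -subv0; apply/subvP=> u.
rewrite memv_cap memv0 => /andP[uC /vlineP[k uE]].
have [a [b [c [axisE abc0 abc6 type0P]]]] := axisP n rs_tip.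
have dot_axis (v : evec n) : dot v (axis n r s) =
    a%:~R * kcoord 1 v + b%:~R * kcoord 2 v + c%:~R * kcoord 3 v.
  rewrite axisE /kcoord /dot !mulr_sumr -!big_split /=.
  by apply: eq_bigr => j _; rewrite !mxE; ring.
have ab0 : a%:~R + b%:~R + c%:~R = 0 :> rat by rewrite -!intrD abc0.
have ab6 : a%:~R ^+ 2 + b%:~R ^+ 2 + c%:~R ^+ 2 = 6 :> rat.
  by rewrite -!rmorphXn -!intrD abc6.
have dot0 (v : evec n) : star_type v = (0, 0) -> dot v (axis n r s) = 0.
  rewrite dot_axis star_typeE => -[v12 v123].
  (* Type (0, 0) forces equal first three coordinates, and the axis coefficients sum to 0. *)
  have -> : kcoord 2 v = kcoord 1 v by lra.
  have -> : kcoord 3 v = kcoord 1 v by lra.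
  by rewrite -!mulrDl ab0 mul0r.
have dot6 : dot (axis n r s) (axis n r s) = 6.
  have N8 : (8 <= edim n)%N by rewrite /edim; lia.
  rewrite dot_axis -ab6 axisE !kcoordE !kcoord_kvec; [|lia..].
  by rewrite /=; ring.
have uw0 : cartan_dot (axis n r s) u = 0.
  move: uC => /(coord_span (X := in_tuple _)) ->.
  rewrite linear_sum big1 // => i _; rewrite linearZ /=.
  set x := nth _ _ _; suff -> : cartan_dot (axis n r s) x = 0 by rewrite scaler0.
  have : x \in in_tuple ([seq xgen F a | a <- roots_of_type t n 0 0] ++
     [seq hvec F t (val a) | a <- roots_of_type t n 0 0]) by rewrite mem_nth.
  rewrite mem_cat => /orP[]/mapP[d]; rewrite mem_roots_of_type => /eqP d0 ->.
    by rewrite /cartan_dot big1 // => j _; rewrite !ffunE [LHS]mulr0.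
  rewrite cartan_dot_hvec // ?dot0 ?(ratr_nat F 0) //.
  exact: in_lattice_Phi (valP d).
move: uw0; rewrite uE linearZ /= cartan_dot_hvec //; last exact: in_lattice_axis.
(* The axis pairs with itself to 6, nonzero in characteristic 0, so k vanishes. *)
rewrite dot6 (ratr_nat F 6) => /eqP; rewrite scaler_eq0 => /orP[/eqP->|].
  by rewrite scale0r.
by rewrite (pcharf0P F).1.
Qed.

Lemma cap_tip_space (F : fieldType) (t : star_kind) (n : nat) (r s : rat)
    (U : {vspace magic_star F t n}) :
  (forall u a, u \in U -> star_type (val a) = (r, s) -> u (inr a) = 0) ->
  (U :&: tip_space F t n r s = 0)%VS.
Proof.
move=> U0; apply/eqP; rewrite -subv0; apply/subvP=> u.
rewrite memv_cap memv0 => /andP[uU uT]; apply/eqP/ffunP=> -[i|a]; rewrite ffunE.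
  exact: tip_cartan_free uT.
have [//|ua0] := eqVneq (u (inr a)) 0.
by rewrite U0 // (tip_root_support uT ua0).
Qed.

Lemma root_support0 (F : fieldType) (t : star_kind) (n : nat) (p q : rat * rat)
    (U : {vspace magic_star F t n}) (u : magic_star F t n) (a : gen_root t n) :
  root_support p U -> p != q -> u \in U -> star_type (val a) = q -> u (inr a) = 0.
Proof.
move=> suppU neq_pq uU aq; apply: contra_neq_eq neq_pq => ua0.
by rewrite -(suppU _ _ uU ua0).
Qed.

Lemma directv_add3 (K : fieldType) (vT : vectType K) (U V W : {vspace vT}) :
  (U :&: V = 0)%VS -> ((U + V) :&: W = 0)%VS -> directv (U + V + W).
Proof.
move=> UV UVW; rewrite directv_addE /= directv_addE /= !directvE /= !eqxx UV UVW.
by rewrite eqxx.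
Qed.

Lemma double_tip_space (F : fieldType) (t : star_kind) (n : nat) (r s : rat) :
  (1 <= n)%N -> (r, s) \in tips -> tip_space F t n (r *+ 2) (s *+ 2) = 0%VS.
Proof.
move=> n_ge1 rs_tip; rewrite /tip_space.
case E : (roots_of_type t n (r *+ 2) (s *+ 2)) => [|a l]; first by rewrite span_nil.
have := mem_head a l; rewrite -E mem_roots_of_type.
by rewrite (negPf (star_type_neq_double_tip n_ge1 rs_tip (valP a))).
Qed.

Lemma tipsN (r s : rat) : (r, s) \in tips -> (- r, - s) \in tips.
Proof.
by rewrite !inE => /or4P[/eqP[-> ->]|/eqP[-> ->]|/eqP[-> ->]|/or3P[]/eqP[-> ->]].
Qed.

(** The bound 2 is what sums of two grades need; for k = 2 and k = -2 both sides are zero by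
    [double_tip_space]. *)
Lemma gIII_grade_subv (F : fieldType) (t : star_kind) (n : nat) (r s : rat) (k : int) :
  (1 <= n)%N -> (r, s) \in tips -> `|k| <= 2 ->
  (tip_space F t n (k%:~R * r) (k%:~R * s) <= gIII_grade F t n r s k)%VS.
Proof.
move=> n_ge1 rs_tip k2.
have : [|| k == 0, k == 1, k == -1, k == 2 | k == -2] by lia.
case/or4P=> [/eqP->|/eqP->|/eqP->|/orP[]/eqP->]; rewrite /gIII_grade /=.
- by rewrite !mul0r; apply: subv_trans (addvSl _ _); apply: tip_center_subv.
- by rewrite !mul1r.
- by rewrite !mulN1r.
- by rewrite !mulr_natl double_tip_space.
by rewrite !mulNr !mulr_natl -!mulNrn double_tip_space // tipsN.
Qed.

Lemma gIII_grade_support (F : fieldType) (t : star_kind) (n : nat) (r s : rat) (k : int) :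
  `|k| <= 1 -> root_support (k%:~R * r, k%:~R * s) (gIII_grade F t n r s k).
Proof.
move=> k1; have : [|| k == 0, k == 1 | k == -1] by lia.
case/or3P=> /eqP->; rewrite /gIII_grade /= ?mul0r ?mul1r ?mulN1r.
- exact: add_axis_root_support.
- exact: tip_root_support.
exact: tip_root_support.
Qed.

Lemma gIII_graded (F : fieldType) (F0 : [pchar F] =i pred0) (t : star_kind)
    (n : nat) (r s : rat) (i j : int) :
  (1 <= n)%N -> (r, s) \in tips -> `|i| <= 1 -> `|j| <= 1 ->
  bracket_in (gIII_grade F t n r s i) (gIII_grade F t n r s j)
             (gIII_grade F t n r s (i + j)).
Proof.
move=> n_ge1 rs_tip i1 j1.
have free k : (k%:~R * r, k%:~R * s) != 0 ->
    cartan_free (gIII_grade F t n r s k).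
  move=> k0 u l; rewrite /gIII_grade; case: eqP => [kE|_].
    by rewrite kE !mul0r in k0.
  do 2 (case: eqP => _; first exact: tip_cartan_free).
  by rewrite memv0 => /eqP->; rewrite ffunE.
apply: bracket_in_type (gIII_grade_support i1) (gIII_grade_support j1) _ _ _ _.
- exact: free.
- exact: free.
- by rewrite /= -!mulrDl -intrD; apply: gIII_grade_subv => //; lia.
(* Opposite types give (i + j)(r, s) = 0, and a tip is nonzero. *)
move=> a ai ji; have -> : i + j = 0.
  apply/eqP; have : (i + j)%:~R * r = 0 /\ (i + j)%:~R * s = 0.
    by case: ji => e1 e2; rewrite !intrD !mulrDl e1 e2 !subrr.
  rewrite -(eqr_int rat); case=> /eqP; rewrite mulf_eq0 => /orP[//|/eqP r0] /eqP.
  by rewrite mulf_eq0 => /orP[//|/eqP s0]; move: rs_tip; rewrite r0 s0.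
exact: hvec_tip ai.
Qed.

Theorem proposition3p1 (F : fieldType) (F_char0 : [pchar F] =i pred0)
    (n : nat) (n_ge1 : (1 <= n)%N) (t : star_kind)
    (r s : rat) (rs_tip : (r, s) \in tips) :
  [/\ subalgebra (center_space F t n),
      subalgebra (tip_space F t n r s) /\
      (forall u v : magic_star F t n,
         u \in tip_space F t n r s -> v \in tip_space F t n r s ->
         bracket u v = 0),
      directv (center_space F t n + axis_space F t n r s +
               tip_space F t n r s + tip_space F t n (- r) (- s)),
      subalgebra (gIII F t n r s)
    & three_graded (gIII F t n r s) (gIII_grade F t n r s)].
Proof.
set C := center_space F t n; set A := axis_space F t n r s.
set Tp := tip_space F t n r s; set Tm := tip_space F t n (- r) (- s).
have rs0 : (r, s) != (0, 0) by apply: contraTneq rs_tip => ->.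
have CA0 : (C :&: A = 0)%VS := center_axis_direct F_char0 t n_ge1 rs_tip.
have suppCA : root_support (0, 0) (C + A)%VS by apply: add_axis_root_support.
have neq_tip : (r, s) != (- r, - s).
  apply: contraNneq rs0 => -[rE sE].
  by apply/eqP; congr pair; lra.
have suppT := @tip_root_support F t n r s.
have suppTm := @tip_root_support F t n (- r) (- s).
have CATp : ((C + A) :&: Tp = 0)%VS.
  by apply: cap_tip_space => u a; apply: root_support0 suppCA _; rewrite eq_sym.
have CATm : ((C + A + Tp) :&: Tm = 0)%VS.
  apply: cap_tip_space => _ a /memv_addP[u uCA [v vT ->]] aT.
  rewrite ffunE (root_support0 suppCA _ uCA aT) ?(root_support0 suppT _ vT aT) ?addr0 //.
  by rewrite eq_sym; apply: contraNneq rs0 => -[/eqP r0 /eqP s0];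
    rewrite !oppr_eq0 in r0 s0; rewrite (eqP r0) (eqP s0).
(* The grading orders the summands as T^-, g_0 + C, T^+, so directness is also needed in that
   order. *)
have TmCA : (Tm :&: (C + A) = 0)%VS.
  rewrite capvC; apply/eqP; rewrite -subv0 -CATm.
  by apply: capvS => //; apply: addvSl.
have TmCATp : ((Tm + (C + A)) :&: Tp = 0)%VS.
  apply: cap_tip_space => _ a /memv_addP[v vT [u uCA ->]] aT.
  rewrite ffunE (root_support0 suppCA _ uCA aT) 1?eq_sym //.
  by rewrite (root_support0 suppTm _ vT aT) ?addr0 // eq_sym.
have dirT : directv (C + A + Tp + Tm).
  by rewrite directv_addE /= directv_add3 //= directvE /= eqxx CATm eqxx.
have TT0 u v : u \in Tp -> v \in Tp -> bracket u v = 0.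
  move=> uT vT; apply/eqP; rewrite -memv0.
  (* The product lies in grade 1 + 1, which is the zero space. *)
  exact: (@gIII_graded F F_char0 t n r s 1 1).
have gr : three_graded (gIII F t n r s) (gIII_grade F t n r s).
  split=> [||k k1|i j i1 j1]; last exact: gIII_graded.
  - exact: etrans (addvC _ _) (addvA _ _ _).
  - exact: directv_add3.
  rewrite /gIII_grade; do 3 (case: eqP => [kE|_]; first by rewrite kE in k1).
  by [].
split=> //.
- apply: (@bracket_in_type F t n (0, 0) (0, 0)); rewrite ?eqxx //.
  + exact: center_root_support.
  + exact: center_root_support.
  + rewrite addr0; exact: tip_center_subv.
  by move=> a a0 _; apply: hvec_center.
- by split=> // u v uT vT; rewrite TT0 // mem0v.
exact: three_graded_subalgebra gr.
Qed.
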